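(* Let $R$ be a commutative ring with identity, $X$ a set, and $(F_X,f_X)$ the free averaging $R$-algebra on $X$ given by $F_X=R[X\cup Y]$, $Y=\{y_\theta:\theta\in\Theta(X)\}$, $f_X(uv)=y_uv$ for $u\in\Theta(X)$, $v\in R[Y]$. Let $I_0$ be the ideal of $F_X$ generated by $y_{1_R}-1_R$ and let $I_1$ be the ideal of $F_X$ generated by the elements $yy'y_{1_R}-yy'$ with $y,y'\in Y$. Let $\bar f_i$ be the operator on $F_X/I_i$ given by $\bar f_i(\alpha+I_i)=f_X(\alpha)+I_i$ ($i=0,1$), let $\pi_i:F_X\to F_X/I_i$ be the canonical homomorphism, and let $j:X\to F_X$ be the inclusion map. Then: (i) Together with the map $i_0=\pi_0\circ j:X\to F_X/I_0$, $(F_X/I_0,\bar f_0)$ is a free unitary averaging $R$-algebra on $X$. (ii) Together with the map $i_1=\pi_1\circ j:X\to F_X/I_1$, $(F_X/I_1,\bar f_1)$ is a free Reynolds-averaging $R$-algebra on $X$.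
   Context: All rings and algebras are commutative with identity, and algebra homomorphisms preserve the identity. An averaging operator on an $R$-algebra $B$ is an $R$-module endomorphism $g:B\to B$ with $g(xg(y))=g(x)g(y)$ for all $x,y\in B$; $(B,g)$ is then an averaging $R$-algebra. It is unitary if $g(1_B)=1_B$. It is a Reynolds-averaging algebra if $g$ also satisfies the Reynolds identity $g(x)g(y)+g(g(x)g(y))=g(xg(y))+g(yg(x))$ for all $x,y\in B$ (for an averaging operator this is equivalent to $g(g(x)g(y))=g(x)g(y)$). $\Theta(X)$ is the set of monomials of $R[X]$ with coefficient $1_R$ (including $1_R$); $Y$ is a set of symbols $y_\theta$, pairwise distinct for distinct $\theta\in\Theta(X)$ and disjoint from $X$; $f_X$ is extended by $R$-linearity. Both $I_0$ and $I_1$ are mapped into themselves by $f_X$, so $\bar f_0,\bar f_1$ are well-defined averaging operators. A unitary averaging (resp. Reynolds-averaging) $R$-algebra $(F,f)$ together with a map $i:X\to F$ is a free unitary averaging (resp. free Reynolds-averaging) $R$-algebra on $X$ if for any unitary averaging (resp. Reynolds-averaging) $R$-algebra $(B,g)$ and any map $\eta:X\to B$ there exists a unique $R$-algebra homomorphism $\hat\varphi:F\to B$ such that $\hat\varphi\circ f=g\circ\hat\varphi$ and $\hat\varphi\circ i=\eta$. *)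

(* Defs.v *)
From HB Require Import structures.
From mathcomp Require Import all_boot all_algebra.
From mathcomp Require Import finmap boolp.
From mathcomp.multinomials Require Import monalg.

Set Implicit Arguments.
Unset Strict Implicit.
Unset Printing Implicit Defensive.

Import GRing.Theory.

Local Open Scope ring_scope.
Local Open Scope quotient_scope.

(* [comAlgType] and the ring structures on [{malg R[K]}] and [{ideal_quot I}]
   require [1 != 0].  Here the zero ring is allowed, both as base ring and as
   algebra, so the three notions are rebuilt over [comPzRingType].  A commutative
   R-algebra is a commutative ring B with a ring morphism R -> B, and c in R acts
   on B as the multiplication by the image of c. *)

Structure algebra (R : comPzRingType) := Algebra {
  alg_ring :> comPzRingType;
  alg_map : {rmorphism R -> alg_ring}
}.

Section Averaging.
Variable R : comPzRingType.

Definition ascale (B : algebra R) (c : R) (x : B) : B := alg_map B c * x.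

Definition module_endo (B : algebra R) (g : B -> B) : Prop :=
  {morph g : x y / x + y} /\ forall c, {morph g : x / ascale c x}.

Definition alg_hom (A B : algebra R) (phi : A -> B) : Prop :=
  [/\ {morph phi : x y / x + y}, {morph phi : x y / x * y}, phi 1 = 1
    & forall c x, phi (ascale c x) = ascale c (phi x)].

Definition averaging_operator (B : algebra R) (g : B -> B) : Prop :=
  module_endo g /\ forall x y, g (x * g y) = g x * g y.

Definition unitary_averaging (B : algebra R) (g : B -> B) : Prop :=
  averaging_operator g /\ g 1 = 1.

Definition Reynolds_averaging (B : algebra R) (g : B -> B) : Prop :=
  averaging_operator g /\
  forall x y, g x * g y + g (g x * g y) = g (x * g y) + g (y * g x).

(* The universal property of a free object on X within a class C of algebras
   with operator. *)
Definition free_in (C : forall B : algebra R, (B -> B) -> Prop)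
    (X : Type) (F : algebra R) (f : F -> F) (i : X -> F) : Prop :=
  C F f /\
  forall (B : algebra R) (g : B -> B), C B g ->
  forall eta : X -> B,
    let extends (phi : F -> B) :=
      [/\ alg_hom phi, phi \o f =1 g \o phi & phi \o i =1 eta] in
    exists phi, extends phi /\ forall psi, extends psi -> psi =1 phi.

Definition free_unitary_averaging := free_in unitary_averaging.
Definition free_Reynolds_averaging := free_in Reynolds_averaging.

End Averaging.

(* The polynomial ring R[I] is [monoid_alg R {cmonom I}]. *)
Definition monoid_alg (R : comPzRingType) (K : conomType) : Type := {malg R[K]}.

HB.instance Definition _ R K := GRing.Zmodule.on (monoid_alg R K).

HB.lock Definition mterm (R : comPzRingType) (K : conomType) (c : R) (k : K)
  : monoid_alg R K := << c *g k >>.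

HB.lock Definition mprod (R : comPzRingType) (K : conomType)
    (p q : monoid_alg R K) : monoid_alg R K :=
  \sum_(k <- msupp p) \sum_(l <- msupp q) mterm (p@_k * q@_l) (mmul k l).

Section MonoidAlgebra.
Variables (R : comPzRingType) (K : conomType).
Local Notation A := (monoid_alg R K).
Implicit Types (p q : A) (c : R) (k : K).
Local Notation mterm := (@mterm R K).
Local Notation mprod := (@mprod R K).

(* [h c k] is the value at the term c k; [mlift h] is additive when [h] is
   additive in c. *)
Definition mlift (V : zmodType) (h : R -> K -> V) p : V :=
  \sum_(k <- msupp p) h p@_k k.

Section Lift.
Variables (V : zmodType) (h : R -> K -> V).
Hypothesis hD : forall k, {morph h^~ k : c d / c + d}.

Let h0 k : h 0 k = 0.
Proof. by apply: (addrI (h 0 k)); rewrite -hD !addr0. Qed.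

Lemma mlift_wide (d : {fset K}) p : (msupp p `<=` d)%fset ->
  mlift h p = \sum_(k <- d) h p@_k k.
Proof.
move=> pd; rewrite /mlift (big_fset_incl _ pd) //= => k _ /mcoeff_outdom ->.
exact: h0.
Qed.

Lemma mliftD : {morph mlift h : p q / p + q}.
Proof.
move=> p q; pose d := (msupp p `|` msupp q)%fset.
rewrite (mlift_wide (msuppD_le p q)).
rewrite (mlift_wide (fsubsetUl (msupp p) (msupp q))).
rewrite (mlift_wide (fsubsetUr (msupp p) (msupp q))) -big_split /=.
by apply: eq_bigr => k _; rewrite mcoeffD hD.
Qed.

Lemma mlift0 : mlift h 0 = 0.
Proof. by apply: (addrI (mlift h 0)); rewrite -mliftD !addr0. Qed.

Lemma mliftU c k : mlift h (mterm c k) = h c k.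
Proof.
by rewrite mterm.unlock (mlift_wide msuppU_le) big_seq_fset1 mcoeffUU.
Qed.

End Lift.

Lemma mtermD k : {morph mterm^~ k : c d / c + d}.
Proof. by move=> c d; rewrite mterm.unlock; exact: monalgUD. Qed.

Lemma mtermE p : p = \sum_(k <- msupp p) mterm p@_k k.
Proof. by rewrite mterm.unlock; exact: monalgE. Qed.

Lemma mterm_ext (V : zmodType) (f g : A -> V) :
    {morph f : p q / p + q} -> {morph g : p q / p + q} ->
    (forall c k, f (mterm c k) = g (mterm c k)) -> f =1 g.
Proof.
move=> fD gD fg p.
have add0 (h : A -> V) : {morph h : p q / p + q} -> h 0 = 0.
  by move=> hD; apply: (addrI (h 0)); rewrite -hD !addr0.
rewrite [p]mtermE (big_morph f fD (add0 f fD)) (big_morph g gD (add0 g gD)).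
by apply: eq_bigr => k _; exact: fg.
Qed.

Lemma mprodDl q : {morph mprod^~ q : p p' / p + p'}.
Proof.
rewrite mprod.unlock.
apply: (@mliftD _ (fun c k =>
  \sum_(l <- msupp q) mterm (c * q@_l) (mmul k l))) => k c d.
by rewrite -big_split; apply: eq_bigr => l _; rewrite mulrDl mtermD.
Qed.

Lemma mprodC : commutative mprod.
Proof.
move=> p q; rewrite mprod.unlock exchange_big; apply: eq_bigr => k _.
by apply: eq_bigr => l _; rewrite mulrC mulmC.
Qed.

Lemma mprodDr p : {morph mprod p : q q' / q + q'}.
Proof. by move=> q q'; rewrite mprodC mprodDl !(mprodC p). Qed.

Lemma mprodUU c d k l :
  mprod (mterm c k) (mterm d l) = mterm (c * d) (mmul k l).
Proof.
rewrite mprod.unlock [LHS](@mliftU _ (fun c k =>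
  \sum_(l' <- msupp (mterm d l)) mterm (c * (mterm d l)@_l') (mmul k l'))).
  apply: (@mliftU _ (fun d l => mterm (c * d) (mmul k l))) => l' x y.
  by rewrite mulrDr mtermD.
move=> k' x y; rewrite -big_split; apply: eq_bigr => l' _.
by rewrite mulrDl mtermD.
Qed.

Lemma mprodA : associative mprod.
Proof.
move=> p q r; move: p; apply: mterm_ext => [p p'|p p'|c k]; rewrite ?mprodDl //.
move: q; apply: mterm_ext => [q q'|q q'|d l].
- by rewrite mprodDl mprodDr.
- by rewrite mprodDr mprodDl.
move: r; apply: mterm_ext => [r r'|r r'|e m]; rewrite ?mprodDr //.
by rewrite !mprodUU mulrA mulmA.
Qed.

Lemma mprod1 : left_id (mterm 1 mone) mprod.
Proof.
apply: mterm_ext => [p q|p q|c k]; rewrite ?mprodDr //.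
by rewrite mprodUU mul1r mul1m.
Qed.

HB.instance Definition _ :=
  GRing.Zmodule_isComPzRing.Build A mprodA mprodC mprod1
    (fun p q r => mprodDl r p q).

Definition mconst c : A := mterm c mone.

Lemma mconst_zmod_morphism : zmod_morphism mconst.
Proof. by move=> c d; rewrite /mconst mterm.unlock; exact: monalgUB. Qed.

Lemma mconst_monoid_morphism : monoid_morphism mconst.
Proof. by split=> // c d; rewrite [RHS]mprodUU /mconst mul1m. Qed.

HB.instance Definition _ :=
  GRing.isZmodMorphism.Build R A mconst mconst_zmod_morphism.
HB.instance Definition _ :=
  GRing.isMonoidMorphism.Build R A mconst mconst_monoid_morphism.

Definition monoid_algebra : algebra R := @Algebra R A mconst.

End MonoidAlgebra.

Section IdealQuotient.
Variables (R : comPzRingType) (A : algebra R) (S : A -> Prop).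

Definition ideal_gen (x : A) : Prop :=
  exists s : seq (A * A),
    (forall ab, ab \in s -> S ab.2) /\ x = \sum_(ab <- s) ab.1 * ab.2.

Definition in_ideal (x : A) : bool := `[< ideal_gen x >].

Lemma ideal_gen0 : ideal_gen 0.
Proof. by exists [::]; rewrite big_nil. Qed.

Lemma ideal_genD x y : ideal_gen x -> ideal_gen y -> ideal_gen (x + y).
Proof.
move=> [s [sS ->]] [t [tS ->]]; exists (s ++ t); rewrite big_cat; split=> // ab.
by rewrite mem_cat => /orP[/sS|/tS].
Qed.

Lemma ideal_genMl a x : ideal_gen x -> ideal_gen (a * x).
Proof.
move=> [s [sS ->]]; exists [seq (a * ab.1, ab.2) | ab <- s]; split.
  by move=> _ /mapP[ab /sS abS ->].
by rewrite big_map mulr_sumr; apply: eq_bigr => ab _; rewrite mulrA.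
Qed.

Lemma in_ideal_zmod_closed : zmod_closed in_ideal.
Proof.
split=> [|x y /asboolP Ix /asboolP Iy]; apply/asboolP; first exact: ideal_gen0.
by apply: ideal_genD => //; rewrite -mulN1r; exact: ideal_genMl.
Qed.

HB.instance Definition _ := GRing.isZmodClosed.Build A in_ideal
  in_ideal_zmod_closed.

Definition ideal_of : zmodClosed A := GRing.ZmodClosed.clone A in_ideal _.

Definition alg_quot : Type := {ideal_quot ideal_of}.

HB.instance Definition _ := GRing.Zmodule.on alg_quot.
HB.instance Definition _ := EqQuotient.on alg_quot.

Definition cls (x : A) : alg_quot := \pi_alg_quot x.

Lemma cls_eq x y : cls x = cls y <-> ideal_gen (x - y).
Proof.
rewrite /cls; split=> [/eqP|I]; last apply/eqP.
  by rewrite -[_ == _]Quotient.idealrBE => /asboolP.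
by rewrite -[_ == _]Quotient.idealrBE; apply/asboolP.
Qed.

Lemma clsK (q : alg_quot) : cls (repr q) = q.
Proof. exact: reprK. Qed.

Lemma clsP (P : alg_quot -> Prop) : (forall x, P (cls x)) -> forall q, P q.
Proof. by move=> Pcls q; rewrite -[q]clsK. Qed.

Lemma clsD : {morph cls : x y / x + y}.
Proof. exact: (raddfD \pi_({ideal_quot ideal_of})). Qed.

Lemma clsB : {morph cls : x y / x - y}.
Proof. exact: (raddfB \pi_({ideal_quot ideal_of})). Qed.

Definition quot_lift (f : A -> A) (q : alg_quot) : alg_quot := cls (f (repr q)).

Lemma quot_liftE (f : A -> A) :
    {morph f : x y / x - y} -> (forall x, ideal_gen x -> ideal_gen (f x)) ->
  forall x, quot_lift f (cls x) = cls (f x).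
Proof.
move=> fB fI x; apply/cls_eq; rewrite -fB; apply: fI.
by apply/cls_eq; rewrite clsK.
Qed.

Definition quot_one : alg_quot := cls 1.
Definition quot_mul (p q : alg_quot) : alg_quot := cls (repr p * repr q).

Lemma quot_mulE x y : quot_mul (cls x) (cls y) = cls (x * y).
Proof.
apply/cls_eq; set x' := repr _; set y' := repr _.
have -> : x' * y' - x * y = y' * (x' - x) + x * (y' - y).
  by rewrite !mulrBr addrA [y' * x' ]mulrC [y' * x]mulrC subrK.
by apply: ideal_genD; apply: ideal_genMl; apply/cls_eq; rewrite clsK.
Qed.

Lemma quot_mulA : associative quot_mul.
Proof.
by elim/clsP=> x; elim/clsP=> y; elim/clsP=> z; rewrite !quot_mulE mulrA.
Qed.

Lemma quot_mulC : commutative quot_mul.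
Proof. by elim/clsP=> x; elim/clsP=> y; rewrite !quot_mulE mulrC. Qed.

Lemma quot_mul1 : left_id quot_one quot_mul.
Proof. by elim/clsP=> x; rewrite quot_mulE mul1r. Qed.

Lemma quot_mulD : left_distributive quot_mul +%R.
Proof.
elim/clsP=> x; elim/clsP=> y; elim/clsP=> z.
by rewrite -clsD !quot_mulE -clsD mulrDl.
Qed.

HB.instance Definition _ := GRing.Zmodule_isComPzRing.Build alg_quot
  quot_mulA quot_mulC quot_mul1 quot_mulD.

Definition quot_map (c : R) : alg_quot := cls (alg_map A c).

Lemma quot_map_zmod_morphism : zmod_morphism quot_map.
Proof. by move=> c d; rewrite /quot_map rmorphB clsB. Qed.

Lemma quot_map_monoid_morphism : monoid_morphism quot_map.
Proof.
by split=> [|c d]; rewrite /quot_map ?rmorph1 // rmorphM -quot_mulE.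
Qed.

HB.instance Definition _ :=
  GRing.isZmodMorphism.Build R alg_quot quot_map quot_map_zmod_morphism.
HB.instance Definition _ :=
  GRing.isMonoidMorphism.Build R alg_quot quot_map quot_map_monoid_morphism.

Definition quot_algebra : algebra R := @Algebra R alg_quot quot_map.

End IdealQuotient.

Section FreeAveraging.
Variables (R : comPzRingType) (X : choiceType).

(* [Theta] is the set of monic monomials in X; it indexes Y, and the variable
   [inr t] of [XY] is the symbol y_t. *)
Definition Theta : choiceType := {cmonom X}.

Definition XY : choiceType := Choice.clone (X + Theta)%type _.
Definition XY_monom : conomType := {cmonom XY}.

Definition FX : algebra R := monoid_algebra R XY_monom.

Definition FX_term (c : R) (m : XY_monom) : FX := mterm c m.

Definition xvar (x : X) : FX := FX_term 1 (ucm (inl x : XY)).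
Definition yvar (t : Theta) : FX := FX_term 1 (ucm (inr t : XY)).

(* The factors u, in the variables X, and v, in the variables Y, of a monomial
   m = uv. *)
Definition xpart (m : XY_monom) : Theta :=
  [cmonom m (inl x) | x in seq_fset tt
     (pmap (fun i => if i is inl x then Some x else None) (finsupp m))]%M.

Definition ypart (m : XY_monom) : XY_monom :=
  [cmonom (if i is inr _ then m i else 0) | i in finsupp m]%M.

Lemma xpartE m x : xpart m x = m (inl x).
Proof.
rewrite cmE fsfun_fun seq_fsetE mem_pmap; case: ifP => // /negbT mx.
apply/esym/eqP; rewrite cmE_eq0; apply: contra mx => mx.
by apply/mapP; exists (inl x).
Qed.

Lemma ypartE m i : ypart m i = if i is inr _ then m i else 0%N.
Proof.
rewrite cmE fsfun_fun; case: ifP => // /negbT; rewrite -cmE_eq0 => /eqP.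
by case: i.
Qed.

Definition fX_monom (m : XY_monom) : XY_monom :=
  mmul (ucm (inr (xpart m) : XY)) (ypart m).

(* f_X(uv) = y_u v on monomials, extended by R-linearity. *)
Definition fX : FX -> FX := mlift (fun c m => FX_term c (fX_monom m)).

Lemma FX_termM c d (m n : XY_monom) :
  FX_term c m * FX_term d n = FX_term (c * d) (mmul m n).
Proof. exact: mprodUU. Qed.

Lemma fX_term c m : fX (FX_term c m) = FX_term c (fX_monom m).
Proof. by apply: mliftU => k; exact: mtermD. Qed.

Lemma fX_uv (u v : XY_monom) :
    (forall t, u (inr t) = 0%N) -> (forall x, v (inl x) = 0%N) ->
  fX (FX_term 1 u * FX_term 1 v) = yvar (xpart u) * FX_term 1 v.
Proof.
move=> uX vY.
have Eu : xpart (mmul u v) = xpart u.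
  by apply/eqP/cmP=> x; rewrite !xpartE cmM vY addn0.
have Ev : ypart (mmul u v) = v.
  by apply/eqP/cmP=> -[x|t]; rewrite ypartE ?vY // cmM uX.
by rewrite /yvar !FX_termM fX_term /fX_monom Eu Ev.
Qed.

Lemma fXD : {morph fX : p q / p + q}.
Proof. by apply: mliftD => k; exact: mtermD. Qed.

Lemma fXB : {morph fX : p q / p - q}.
Proof.
have fXN p : fX (- p) = - fX p.
  apply: (addrI (fX p)); rewrite -fXD !subrr /fX mlift0 // => k.
  exact: mtermD.
by move=> p q; rewrite fXD fXN.
Qed.

Lemma fXMy p t : fX (p * yvar t) = fX p * yvar t.
Proof.
move: p; apply: mterm_ext => [p q|p q|c m].
- by rewrite mulrDl fXD.
- by rewrite fXD mulrDl.
have Ex : xpart (mmul m (ucm (inr t : XY))) = xpart m.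
  by apply/eqP/cmP=> x; rewrite !xpartE cmM cmU addn0.
have Ey : ypart (mmul m (ucm (inr t : XY))) = mmul (ypart m) (ucm (inr t : XY)).
  by apply/eqP/cmP=> -[x|s]; rewrite !(ypartE, cmM) ?cmU.
rewrite -/(FX_term c m) fX_term /yvar !FX_termM fX_term.
by rewrite /fX_monom Ex Ey mulmA.
Qed.

Lemma fX_linM z w :
    (forall p, fX (p * z) = fX p * z) -> (forall p, fX (p * w) = fX p * w) ->
  forall p, fX (p * (z * w)) = fX p * (z * w).
Proof. by move=> zP wP p; rewrite [p * _]mulrA wP zP -mulrA. Qed.

Lemma fX_linB z w :
    (forall p, fX (p * z) = fX p * z) -> (forall p, fX (p * w) = fX p * w) ->
  forall p, fX (p * (z - w)) = fX p * (z - w).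
Proof. by move=> zP wP p; rewrite [p * _]mulrBr fXB zP wP -mulrBr. Qed.

Lemma fX_ideal (S : FX -> Prop) :
    (forall z p, S z -> fX (p * z) = fX p * z) ->
  forall p, ideal_gen S p -> ideal_gen S (fX p).
Proof.
move=> Sf p [s [sS ->]]; elim: s sS => [|ab s IH] sS.
  rewrite big_nil /fX mlift0; first exact: ideal_gen0.
  by move=> k; exact: mtermD.
rewrite big_cons fXD; apply: ideal_genD; last first.
  by apply: IH => cd cds; apply: sS; rewrite inE cds orbT.
have Sab : S ab.2 by apply: sS; rewrite inE eqxx.
rewrite Sf //; apply: ideal_genMl; exists [:: (1, ab.2)].
by rewrite big_seq1 mul1r; split=> // cd; rewrite inE => /eqP->.
Qed.

Definition I0_gen (z : FX) : Prop := z = yvar mone - 1.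

Definition I1_gen (z : FX) : Prop :=
  exists t t' : Theta, z = yvar t * yvar t' * yvar mone - yvar t * yvar t'.

Definition fbar0 : quot_algebra I0_gen -> quot_algebra I0_gen :=
  quot_lift (S := I0_gen) fX.
Definition fbar1 : quot_algebra I1_gen -> quot_algebra I1_gen :=
  quot_lift (S := I1_gen) fX.

Lemma fbar0E p : fbar0 (cls I0_gen p) = cls I0_gen (fX p).
Proof.
apply: quot_liftE; first exact: fXB.
apply: fX_ideal => z q ->; apply: (fX_linB (z := yvar mone) (w := 1)) => r.
  exact: fXMy.
by rewrite !mulr1.
Qed.

Lemma fbar1E p : fbar1 (cls I1_gen p) = cls I1_gen (fX p).
Proof.
apply: quot_liftE; first exact: fXB.
have yM s s' r : fX (r * (yvar s * yvar s')) = fX r * (yvar s * yvar s').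
  by apply: fX_linM => r'; exact: fXMy.
apply: fX_ideal => z q [t [t' ->]].
apply: (fX_linB (z := yvar t * yvar t' * yvar mone)) => // r.
by apply: (fX_linM (z := yvar t * yvar t')) => // r'; exact: fXMy.
Qed.

End FreeAveraging.

(* Main.v *)
(** A map [eta : X -> B] into an averaging algebra [(B, g)] extends to the
algebra homomorphism [phi] on the polynomials sending [y_t] to [g (eta t)].  Moving
the values of [g] out one at a time gives [g (b y) = g b * y] for every product
[y] of values of [g], so [phi] commutes with the operators; it is unique since
[y_t = f_X t].  In B, [phi] maps [y_1] to [g 1], and
[g (g a * g b) = g (1 * g a * g b) = g 1 * g a * g b], so [phi] kills [y_1 - 1]
when [g] is unitary and kills [y y' y_1 - y y'] when [g] is Reynolds.
Conversely, [f_X 1 = y_1] is 1 modulo [I_0]; and [f_X (p q) = y_1 p q] for [p],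
[q] in the image of [f_X], which is [p q] modulo [I_1], as every term of [p] and
of [q] has a factor in Y. *)

Require Import Defs.
From mathcomp Require Import all_boot all_algebra.
From mathcomp Require Import finmap boolp.
From mathcomp.multinomials Require Import monalg.

Set Implicit Arguments.
Unset Strict Implicit.
Unset Printing Implicit Defensive.

Import GRing.Theory.

Local Open Scope ring_scope.

(** * Induction on monomials and their evaluation in a ring *)

Lemma cmonom_ind (I : choiceType) (P : {cmonom I} -> Prop) :
    P mone -> (forall i m, P m -> P (mmul (ucm i) m)) ->
  forall m, P m.
Proof.
(* Strong induction on the degree: dividing by a variable that occurs lowers it by one. *)
move=> P1 PM m; have [n] := ubnP (mdeg m); elim: n => // n IH in m *.
have [->//|m1] := eqVneq m mone.
have [i mi] : exists i, m i != 0%N.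
  apply: contra_neqP m1 => /forallNP m0; apply/eqP/cmP => i.
  by rewrite cm1; apply/eqP/negPn/negP/m0.
(* [divcm] subtracts exponents with truncation at 0; the division is exact because [m i] is
   positive. *)
have -> : m = mmul (ucm i) (divcm m (ucm i)).
  apply/eqP/cmP => j; rewrite cmM divcmE cmU; case: eqP => [<-|] /=.
    by rewrite add1n subn1 prednK // lt0n.
  by rewrite add0n subn0.
by rewrite mdegM mdegU => mn; apply: PM; apply: IH.
Qed.

Section Evaluation.
Variables (I : choiceType) (B : comPzRingType).
Implicit Types (h : I -> B) (m : {cmonom I}).

Definition mon_eval h m : B := \prod_(i <- finsupp m) h i ^+ m i.

(** Variables outside the support contribute a 0th power, so the products for two monomials can run
    over a common index set. *)
Lemma mon_eval_wide h m (d : {fset I}) : (finsupp m `<=` d)%fset ->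
  mon_eval h m = \prod_(i <- d) h i ^+ m i.
Proof.
move=> md; rewrite /mon_eval (big_fset_incl _ md) //= => i _.
by rewrite -cmE_eq0 => /eqP ->.
Qed.

Lemma mon_eval1 h : mon_eval h mone = 1.
Proof. by rewrite /mon_eval mdom1 big_seq_fset0. Qed.

Lemma mon_evalU h i : mon_eval h (ucm i) = h i.
Proof. by rewrite /mon_eval mdomU big_seq_fset1 cmUU. Qed.

Lemma mon_evalM h m n : mon_eval h (mmul m n) = mon_eval h m * mon_eval h n.
Proof.
rewrite [LHS]/mon_eval mdomD.
rewrite (mon_eval_wide h (fsubsetUl (finsupp m) (finsupp n))).
rewrite (mon_eval_wide h (fsubsetUr (finsupp m) (finsupp n))) -big_split /=.
by apply: eq_bigr => i _; rewrite cmM exprD.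
Qed.

(** Agreement is asked only on the variables that occur: uniqueness compares two maps on monomials
    in [X] before anything is known on [Y]. *)
Lemma eq_mon_eval h h' m : (forall i, m i != 0%N -> h i = h' i) ->
  mon_eval h m = mon_eval h' m.
Proof. by move=> hh'; apply: eq_big_seq => i; rewrite -cmE_neq0 => /hh' ->. Qed.

End Evaluation.

(** * The factors of a monomial in X and in Y *)

Section Parts.
Variable X : choiceType.
Implicit Types (m n : XY_monom X) (t : Theta X).

Lemma xpartM m n : xpart (mmul m n) = mmul (xpart m) (xpart n).
Proof. by apply/eqP/cmP => x; rewrite cmM !xpartE cmM. Qed.

Lemma ypartM m n : ypart (mmul m n) = mmul (ypart m) (ypart n).
Proof. by apply/eqP/cmP => -[x|t]; rewrite cmM !ypartE ?cmM. Qed.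

Lemma xpart1 : xpart (mone : XY_monom X) = mone.
Proof. by apply/eqP/cmP => x; rewrite xpartE !cm1. Qed.

Lemma ypart1 : ypart (mone : XY_monom X) = mone.
Proof. by apply/eqP/cmP => -[x|t]; rewrite ypartE !cm1. Qed.

Lemma xpartUl x : xpart (ucm (inl x : XY X)) = ucm x.
Proof. by apply/eqP/cmP => y; rewrite xpartE !cmU. Qed.

Lemma xpartUr t : xpart (ucm (inr t : XY X)) = mone.
Proof. by apply/eqP/cmP => y; rewrite xpartE cmU cm1. Qed.

Lemma ypartUl x : ypart (ucm (inl x : XY X)) = mone.
Proof. by apply/eqP/cmP => -[y|t]; rewrite ypartE ?cmU cm1. Qed.

Lemma ypartUr t : ypart (ucm (inr t : XY X)) = ucm (inr t : XY X).
Proof. by apply/eqP/cmP => -[y|s]; rewrite ypartE ?cmU. Qed.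

(** A section of [xpart]: it embeds the monomials in [X], so that the variable y_t becomes a value
    of f_X. *)
Definition xmonom t : XY_monom X :=
  [cmonom (if i is inl x then t x else 0) |
    i in seq_fset tt (map (fun x => inl x : XY X) (finsupp t))]%M.

Lemma xmonomE t i : xmonom t i = if i is inl x then t x else 0%N.
Proof.
rewrite cmE fsfun_fun seq_fsetE; case: ifP => // /negbT.
case: i => // x tx; apply/esym/eqP; rewrite cmE_eq0.
by apply: contra tx => tx; apply/mapP; exists x.
Qed.

Lemma fX_xmonom t : fX_monom (xmonom t) = ucm (inr t : XY X).
Proof.
rewrite /fX_monom; have -> : ypart (xmonom t) = mone.
  by apply/eqP/cmP => -[x|s]; rewrite ypartE ?xmonomE cm1.
have -> : xpart (xmonom t) = t by apply/eqP/cmP => x; rewrite xpartE xmonomE.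
by rewrite mulm1.
Qed.

Lemma mon_eval_xy (B : comPzRingType) (h : XY X -> B) m :
  mon_eval h m = mon_eval (h \o inl) (xpart m) * mon_eval h (ypart m).
Proof.
elim/cmonom_ind: m => [|[x|t] m IH].
- by rewrite xpart1 ypart1 !mon_eval1 mulr1.
- rewrite xpartM ypartM xpartUl ypartUl !mon_evalM !mon_evalU mon_eval1 IH.
  by rewrite mul1r mulrA.
rewrite xpartM ypartM xpartUr ypartUr !mon_evalM !mon_evalU mon_eval1 IH.
by rewrite mul1r mulrCA.
Qed.

(** The Y-part is a product of variables of [Y], so a multiplicative property passes to it from
    their values. The property used below is that an operator is linear over the element. *)
Lemma mon_eval_ypart (B : comPzRingType) (P : B -> Prop) (h : XY X -> B) m :
    P 1 -> (forall a b, P a -> P b -> P (a * b)) ->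
    (forall t, P (h (inr t))) ->
  P (mon_eval h (ypart m)).
Proof.
move=> P1 PM Ph; elim/cmonom_ind: m => [|[x|t] m IH].
- by rewrite ypart1 mon_eval1.
- by rewrite ypartM ypartUl mul1m.
by rewrite ypartM ypartUr mon_evalM mon_evalU; exact: PM.
Qed.

End Parts.

(** * Algebra homomorphisms and quotients by ideals *)

Section AlgebraHom.
Variable R : comPzRingType.

Lemma ascale1 (A : algebra R) c : ascale c (1 : A) = alg_map A c.
Proof. exact: mulr1. Qed.

Lemma alg_hom_comp (A B C : algebra R) (psi : B -> C) (phi : A -> B) :
  alg_hom psi -> alg_hom phi -> alg_hom (psi \o phi).
Proof.
move=> [sD sM s1 sZ] [pD pM p1 pZ]; split=> [x y|x y||c x] /=.
- by rewrite pD sD.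
- by rewrite pM sM.
- by rewrite p1 s1.
- by rewrite pZ sZ.
Qed.

Lemma alg_homB (A B : algebra R) (phi : A -> B) : alg_hom phi ->
  {morph phi : x y / x - y}.
Proof.
by move=> [pD _ _ _] x y; apply: (addIr (phi y)); rewrite -pD !subrK.
Qed.

Section Quotient.
Variables (A : algebra R) (S : A -> Prop).
Local Notation Q := (quot_algebra S).

Lemma clsM : {morph (cls S : A -> Q) : x y / x * y}.
Proof. by move=> x y; rewrite [RHS]quot_mulE. Qed.

Lemma alg_hom_cls : alg_hom (cls S : A -> Q).
Proof.
by split=> //; [exact: clsD | exact: clsM | move=> c x; rewrite [LHS]clsM].
Qed.

Lemma alg_hom_ideal (B : algebra R) (phi : A -> B) : alg_hom phi ->
  (forall z, S z -> phi z = 0) -> forall x, ideal_gen S x -> phi x = 0.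
Proof.
move=> /[dup] phiB [pD pM _ _] phiS x [s [sS ->]].
have p0 : phi 0 = 0 by rewrite -(subrr 0) alg_homB // subrr.
rewrite (big_morph phi pD p0) big_seq big1 // => ab /sS abS.
by rewrite pM (phiS _ abS) mulr0.
Qed.

(** Evaluation at a chosen representative; this is the factorization of [phi] once [phi] kills
    [S]. *)
Definition quot_hom (B : algebra R) (phi : A -> B) (q : Q) : B := phi (repr q).

Lemma quot_homE (B : algebra R) (phi : A -> B) : alg_hom phi ->
  (forall z, S z -> phi z = 0) -> forall x, quot_hom phi (cls S x) = phi x.
Proof.
move=> phiB phiS x; apply/subr0_eq; rewrite -alg_homB //.
by apply: alg_hom_ideal => //; apply/cls_eq; rewrite clsK.
Qed.

Lemma alg_hom_quot (B : algebra R) (phi : A -> B) : alg_hom phi ->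
  (forall z, S z -> phi z = 0) -> alg_hom (quot_hom phi).
Proof.
move=> /[dup] phiB [pD pM p1 pZ] phiS; have E := quot_homE phiB phiS.
split.
- by elim/clsP=> x; elim/clsP=> y; rewrite -[_ + _]clsD !E.
- by elim/clsP=> x; elim/clsP=> y; rewrite -[_ * _]clsM !E.
- by rewrite [LHS]E.
- by move=> c; elim/clsP=> x; have [_ _ _ <-] := alg_hom_cls; rewrite !E.
Qed.

Lemma averaging_operator_quot (f : A -> A) (g : Q -> Q) :
    averaging_operator f -> (forall x, g (cls S x) = cls S (f x)) ->
  averaging_operator g.
Proof.
move=> [[fD fZ] fM] gE; have [cD cM _ cZ] := alg_hom_cls; split; first split.
- by elim/clsP=> x; elim/clsP=> y; rewrite -[_ + _]cD !gE fD.
- by move=> c; elim/clsP=> x; rewrite -cZ !gE fZ.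
by elim/clsP=> x; elim/clsP=> y; rewrite gE -cM !gE -cM fM.
Qed.

End Quotient.

(** * Homomorphisms out of the polynomial algebra *)

Section Polynomials.
Variable X : choiceType.
Local Notation FX := (FX R X).
Local Notation var i := (FX_term (1 : R) (ucm (i : XY X))).

Lemma FX_termZ c (m : XY_monom X) : FX_term c m = ascale c (FX_term (1 : R) m).
Proof. by rewrite [RHS]FX_termM mulr1 mul1m. Qed.

Lemma FX_term1 (m : XY_monom X) :
  FX_term (1 : R) m = mon_eval (fun i => var i) m.
Proof.
elim/cmonom_ind: m => [|i m IH]; first by rewrite mon_eval1.
by rewrite mon_evalM mon_evalU -IH FX_termM mulr1.
Qed.

Lemma alg_hom_term (B : algebra R) (phi : FX -> B) c m : alg_hom phi ->
  phi (FX_term c m) = ascale c (mon_eval (fun i => phi (var i)) m).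
Proof.
move=> [pD pM p1 pZ]; rewrite FX_termZ pZ; congr ascale.
elim/cmonom_ind: m => [|i m IH]; first by rewrite mon_eval1.
by rewrite mon_evalM mon_evalU -IH -pM FX_termM mulr1.
Qed.

Lemma alg_hom_ext (B : algebra R) (phi psi : FX -> B) :
    alg_hom phi -> alg_hom psi -> (forall i, phi (var i) = psi (var i)) ->
  phi =1 psi.
Proof.
move=> phiB psiB E; apply: mterm_ext => [||c m].
- by case: phiB.
- by case: psiB.
rewrite [LHS]alg_hom_term // [RHS]alg_hom_term //; congr ascale.
by apply: eq_mon_eval => i _.
Qed.

Section Eval.
Variables (B : algebra R) (h : XY X -> B).

Definition eval : FX -> B := mlift (fun c m => ascale c (mon_eval h m)).

Lemma evalD : {morph eval : p q / p + q}.
Proof. by apply: mliftD => m c d; rewrite /ascale rmorphD mulrDl. Qed.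

Lemma eval_term c m : eval (FX_term c m) = ascale c (mon_eval h m).
Proof. by apply: mliftU => k x y; rewrite /ascale rmorphD mulrDl. Qed.

Lemma evalM : {morph eval : p q / p * q}.
Proof.
move=> p q; move: p; apply: mterm_ext => [p p'|p p'|c m].
- by rewrite mulrDl evalD.
- by rewrite evalD mulrDl.
move: q; apply: mterm_ext => [q q'|q q'|d n].
- by rewrite mulrDr evalD.
- by rewrite evalD mulrDr.
rewrite -!/(FX_term _ _) FX_termM !eval_term mon_evalM /ascale rmorphM.
by rewrite mulrACA.
Qed.

Lemma alg_hom_eval : alg_hom eval.
Proof.
have E c : eval (FX_term c mone) = alg_map B c.
  by rewrite eval_term mon_eval1 ascale1.
split=> [||| c p]; [exact: evalD | exact: evalM | |].
- by rewrite -[1]/(FX_term (1 : R) mone) E rmorph1.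
- by rewrite -[ascale c p]/(FX_term c mone * p) evalM E.
Qed.

Lemma eval_var i : eval (var i) = h i.
Proof. by rewrite eval_term mon_evalU /ascale rmorph1 mul1r. Qed.

End Eval.

(** * The extension of a map into an averaging algebra *)

Section Operator.
Variables (B : algebra R) (g : B -> B).
Hypothesis gav : averaging_operator g.

Lemma averaging_mon_eval (h : XY X -> B) (k : Theta X -> B) m b :
    (forall t, h (inr t) = g (k t)) ->
  g (b * mon_eval h (ypart m)) = g b * mon_eval h (ypart m).
Proof.
case: gav => _ gM hk; move: b.
apply: (mon_eval_ypart (P := fun z => forall b, g (b * z) = g b * z)).
- by move=> b; rewrite !mulr1.
- by move=> y z yP zP b; rewrite mulrA zP yP mulrA.
- by move=> t b; rewrite hk gM.
Qed.

Section Extension.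
Variable eta : X -> B.

Definition free_hom : FX -> B :=
  eval (fun i => match i with inl x => eta x | inr t => g (mon_eval eta t) end).

Lemma free_hom_xvar x : free_hom (xvar R x) = eta x.
Proof. exact: eval_var. Qed.

Lemma free_hom_yvar t : free_hom (yvar R t) = g (mon_eval eta t).
Proof. exact: eval_var. Qed.

Lemma free_hom_fX p : free_hom (fX p) = g (free_hom p).
Proof.
case: (gav) => [[gD gZ] _]; move: p; apply: mterm_ext => [p q|p q|c m].
- by rewrite fXD [LHS]evalD.
- by rewrite [free_hom _]evalD gD.
rewrite -/(FX_term c m) fX_term /free_hom !eval_term gZ; congr ascale.
(* For a monomial uv, the left side is the value of y_u v; on the right, the value of v is moved out
   of [g]. *)
rewrite mon_evalM mon_evalU [in RHS]mon_eval_xy.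
by rewrite (@averaging_mon_eval _ (mon_eval eta)).
Qed.

Lemma free_hom_unique (phi psi : FX -> B) : alg_hom phi -> alg_hom psi ->
    (forall p, phi (fX p) = g (phi p)) -> (forall p, psi (fX p) = g (psi p)) ->
    (forall x, phi (xvar R x) = psi (xvar R x)) ->
  phi =1 psi.
Proof.
move=> phiB psiB phif psif E; apply: alg_hom_ext => // -[x|t]; first exact: E.
(* With y_t written as f_X of the monomial t, both values are [g] of an evaluation that involves
   only variables of [X]. *)
rewrite -fX_xmonom -fX_term phif psif !alg_hom_term //; congr (g (ascale _ _)).
by apply: eq_mon_eval => -[x _|s]; [exact: E | rewrite xmonomE].
Qed.

End Extension.
End Operator.

(** * The operator on polynomials is averaging *)

Lemma fX_termE c (m : XY_monom X) :
  fX (FX_term c m) = ascale c (FX_term (1 : R) (ypart m)) * yvar R (xpart m).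
Proof. by rewrite fX_term -FX_termZ FX_termM mulr1 mulmC. Qed.

Lemma fX_ascale c (p : FX) : fX (ascale c p) = ascale c (fX p).
Proof.
move: p; apply: mterm_ext => [p q|p q|d m].
- by rewrite /ascale mulrDr fXD.
- by rewrite fXD /ascale mulrDr.
rewrite -/(FX_term d m) /ascale fX_term !FX_termM !fX_term /fX_monom.
by rewrite !mul1m.
Qed.

(** Each term of [fX q] is a scalar times a product of variables of [Y], and [fX] is linear over
    every such variable by [fXMy]. *)
Lemma fXMf (p q : FX) : fX (p * fX q) = fX p * fX q.
Proof.
move: q; apply: mterm_ext => [q q'|q q'|c m].
- by rewrite fXD mulrDr fXD.
- by rewrite fXD mulrDr.
rewrite -/(FX_term c m) fX_termE mulrA fXMy mulrA; congr (_ * _).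
rewrite /ascale mulrCA [LHS]fX_ascale [RHS]mulrCA; congr (_ * _).
rewrite FX_term1; move: p.
apply: (mon_eval_ypart (P := fun z => forall p, fX (p * z) = fX p * z)).
- by move=> p; rewrite !mulr1.
- by move=> y z yP zP; apply: fX_linM.
- by move=> t p; exact: fXMy.
Qed.

Lemma averaging_operator_fX : averaging_operator (@fX R X).
Proof.
by split; first split; [exact: fXD | exact: fX_ascale | exact: fXMf].
Qed.

Lemma fX_fM (p q : FX) : fX (fX p * fX q) = yvar R mone * (fX p * fX q).
Proof.
rewrite fXMf -[fX p]mul1r fXMf mul1r mulrA; congr (_ * _ * _).
by rewrite [LHS]fX_term /fX_monom xpart1 ypart1 mulm1.
Qed.

End Polynomials.
End AlgebraHom.

(** * The universal property of the quotients *)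

Section FreeQuotient.
Variables (R : comPzRingType) (X : choiceType).
Variables (S : FX R X -> Prop).
Local Notation Q := (quot_algebra S).
Variable C : forall B : algebra R, (B -> B) -> Prop.
Variable f : Q -> Q.
Hypothesis CF : C f.
Hypothesis fE : forall p, f (cls S p) = cls S (fX p).
Hypothesis C_averaging :
  forall (B : algebra R) (g : B -> B), C g -> averaging_operator g.
Hypothesis C_killed : forall (B : algebra R) (g : B -> B) (eta : X -> B),
  C g -> forall z, S z -> free_hom g eta z = 0.

(** Every algebra in [C] is averaging, so [eta] extends to the polynomials; this extension kills [S]
    and factors through the quotient. *)
Lemma free_in_quot : free_in C f (cls S \o @xvar R X).
Proof.
split=> // B g Cg eta extends; have gav := C_averaging Cg.
have pB : alg_hom (free_hom g eta) by exact: alg_hom_eval.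
have pS := C_killed eta Cg; have E := quot_homE pB pS.
exists (quot_hom (free_hom g eta)); split; first split.
- exact: alg_hom_quot.
- by elim/clsP=> p /=; rewrite fE !E free_hom_fX.
- by move=> x /=; rewrite E free_hom_xvar.
move=> psi [psiB psif psix]; elim/clsP=> p; rewrite E.
(* Uniqueness is pulled back along the projection to the polynomials. *)
have psicB := alg_hom_comp psiB (alg_hom_cls S).
apply: (free_hom_unique (phi := psi \o cls S) (g := g)) => //=.
- by move=> q; rewrite -fE [LHS]psif.
- exact: free_hom_fX.
by move=> x; rewrite [LHS]psix free_hom_xvar.
Qed.

End FreeQuotient.

(** * The unitary and the Reynolds quotients *)

Lemma ideal_gen_sub (R : comPzRingType) (A : algebra R) (S : A -> Prop) z :
  S z -> ideal_gen S z.
Proof.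
move=> Sz; exists [:: (1, z)]; rewrite big_seq1 mul1r; split=> // ab.
by rewrite inE => /eqP ->.
Qed.

(** For an averaging operator both summands on the right of the Reynolds identity equal [g x * g y],
    one of which cancels. *)
Lemma Reynolds_averagingP (R : comPzRingType) (B : algebra R) (g : B -> B) :
  averaging_operator g ->
  Reynolds_averaging g <-> forall x y, g (g x * g y) = g x * g y.
Proof.
move=> gav; have E x y : g (x * g y) + g (y * g x) = g x * g y + g x * g y.
  by case: gav => _ gM; rewrite !gM [g y * _]mulrC.
split=> [[_ gR] x y|gR]; first by apply: (addrI (g x * g y)); rewrite gR E.
by split=> // x y; rewrite E gR.
Qed.

Lemma unitary_averaging_fbar0 (R : comPzRingType) (X : choiceType) :
  unitary_averaging (@fbar0 R X).
Proof.
split.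
  exact: averaging_operator_quot (@averaging_operator_fX R X) (@fbar0E R X).
rewrite [LHS]fbar0E; apply/cls_eq/ideal_gen_sub.
by rewrite [fX _]fX_term /fX_monom xpart1 ypart1 mulm1.
Qed.

Lemma Reynolds_averaging_fbar1 (R : comPzRingType) (X : choiceType) :
  Reynolds_averaging (@fbar1 R X).
Proof.
have av := averaging_operator_quot (@averaging_operator_fX R X) (@fbar1E R X).
apply/(Reynolds_averagingP av); elim/clsP=> p; elim/clsP=> q.
have [_ cM _ _] := alg_hom_cls (@I1_gen R X).
rewrite (fbar1E p) (fbar1E q) -cM fbar1E fX_fM.
(* Both sides are additive in [p] and in [q], so single terms suffice. *)
move: p; apply: mterm_ext => [p p'|p p'|c m].
- by rewrite fXD mulrDl mulrDr clsD.
- by rewrite fXD mulrDl clsD.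
move: q; apply: mterm_ext => [q q'|q q'|d n].
- by rewrite fXD !mulrDr clsD.
- by rewrite fXD mulrDr clsD.
(* One factor of [Y] is isolated from each term; their product y satisfies y y_1 = y modulo the
   ideal, by the choice of generators. *)
rewrite -!/(FX_term _ _) !fX_termE mulrACA; apply/cls_eq.
have E (a y : FX R X) :
    yvar R mone * (a * y) - a * y = a * (y * yvar R mone - y).
  by rewrite mulrBr mulrCA [yvar R mone * y]mulrC.
by rewrite E; apply/ideal_genMl/ideal_gen_sub; do 2!eexists.
Qed.

Theorem proposition2p16 (R : comPzRingType) (X : choiceType) :
  free_unitary_averaging (F := quot_algebra (@I0_gen R X))
    (@fbar0 R X) (cls (@I0_gen R X) \o @xvar R X) /\
  free_Reynolds_averaging (F := quot_algebra (@I1_gen R X))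
    (@fbar1 R X) (cls (@I1_gen R X) \o @xvar R X).
Proof.
split; apply: free_in_quot => //.
- exact: unitary_averaging_fbar0.
- exact: fbar0E.
- by move=> B g [].
- move=> B g eta [_ g1] z ->.
  have pB : alg_hom (free_hom g eta) by exact: alg_hom_eval.
  have [_ _ p1 _] := pB; rewrite alg_homB // p1.
  by rewrite [X in X - _]free_hom_yvar mon_eval1 g1 subrr.
- exact: Reynolds_averaging_fbar1.
- exact: fbar1E.
- by move=> B g [].
move=> B g eta gR z [t [t' ->]]; have gav := gR.1.
have pB : alg_hom (free_hom g eta) by exact: alg_hom_eval.
move: (free_hom g eta) pB (free_hom_yvar g eta) => phi pB phiy.
have [_ pM _ _] := pB; rewrite alg_homB //.
(* Opaque variables: [rewrite !pM] on the monomials themselves diverges, trying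
   to unfold each [yvar R t] to a product. *)
move: (yvar R t) (yvar R t') (yvar R mone) (phiy t) (phiy t') (phiy mone).
move=> y y' y1 phiyt phiyt'; rewrite mon_eval1 !pM phiyt phiyt' => ->.
(* The averaging identity is applied twice, the second time to [1 * g a], which produces the factor
   [g 1]. *)
have <- :
    g (g (mon_eval eta t) * g (mon_eval eta t')) =
    g (mon_eval eta t) * g (mon_eval eta t') * g 1.
  by have gM := gav.2; rewrite gM -{1}[g (mon_eval eta t)]mul1r gM -mulrA mulrC.
have /(Reynolds_averagingP gav) -> := gR.
by rewrite subrr.
Qed.
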